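(* Let $\varphi\in C(\mathbb{R}^2)$ be compactly supported and positive definite, with Sobolev smoothness $\nu_2(\varphi)>1/2$, $\widehat{\varphi}(\boldsymbol{0})>0$ and $\operatorname{supp}(\varphi)\subseteq[N_1,M_1]\times[N_2,M_2]$. Let $f\in V(\varphi,\mathbb{Z}^2)$ be an arbitrary target function with $\operatorname{supp}(f)\subseteq[a_1,b_1]\times[a_2,b_2]$. Let $$E=\{\boldsymbol{k}_1,\dots,\boldsymbol{k}_{\#E}\}=\big([\lceil a_1-M_1\rceil,\lfloor b_1-N_1\rfloor]\times[\lceil a_2-M_2\rceil,\lfloor b_2-N_2\rfloor]\big)\cap\mathbb{Z}^2,$$ and let $E^+=\emptyset$ if $\#E=1$ and $E^+=\{\boldsymbol{x}-\boldsymbol{y}:\boldsymbol{x}\neq\boldsymbol{y}\in E\}$ if $\#E>1$. Then for every direction vector $\boldsymbol{p}\in\{(\cos\theta,\sin\theta):\theta\in[0,2\pi)\}\setminus\mathrm{dv}_{\mathcal{N}_{E^+}}$, $f$ can be determined uniquely by its single-angle Radon samples (with respect to $\boldsymbol{p}$) at $\{\boldsymbol{p}\boldsymbol{k}_1,\dots,\boldsymbol{p}\boldsymbol{k}_{\#E}\}$.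
   Context: Vectors in $\mathbb{R}^2$ are columns; a direction vector $\boldsymbol{p}=(\cos\theta,\sin\theta)$ is a row vector, so $\boldsymbol{p}\boldsymbol{k}=k_1\cos\theta+k_2\sin\theta$. $\mathcal{R}_{\boldsymbol{p}}f(t)=\int_{-\infty}^{\infty}f(t\cos\theta-s\sin\theta,\,t\sin\theta+s\cos\theta)\,ds$. The Fourier transform is $\widehat{g}(\gamma)=\int_{\mathbb{R}^d}g(\boldsymbol{x})e^{-i\boldsymbol{x}\cdot\gamma}d\boldsymbol{x}$. $H^\varsigma(\mathbb{R}^d)=\{g:\int_{\mathbb{R}^d}|\widehat g(\xi)|^2(1+\|\xi\|_2^2)^{\varsigma}d\xi<\infty\}$ and $\nu_2(g)=\sup\{\varsigma:g\in H^\varsigma(\mathbb{R}^d)\}$. A function $\phi:\mathbb{R}^d\to\mathbb{C}$ is positive definite if for all $N\in\mathbb{N}$, all sets of (distinct) points $\{\boldsymbol{x}_1,\dots,\boldsymbol{x}_N\}\subseteq\mathbb{R}^d$ and all $\boldsymbol{0}\neq(\alpha_1,\dots,\alpha_N)^T\in\mathbb{C}^N$ one has $\sum_{j,k=1}^N\alpha_j\overline{\alpha_k}\phi(\boldsymbol{x}_j-\boldsymbol{x}_k)>0$. $V(\varphi,\mathbb{Z}^2)=\{\sum_{\boldsymbol{k}\in\mathbb{Z}^2}c_{\boldsymbol{k}}\varphi(\cdot-\boldsymbol{k}):\sum_{\boldsymbol{k}}|c_{\boldsymbol{k}}|^2<\infty\}$, and throughout $\{\varphi(\cdot-\boldsymbol{k}):\boldsymbol{k}\in\mathbb{Z}^2\}$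 is linearly independent in $L^2(\mathbb{R}^2)$. For $\mathcal{S}\subseteq\mathbb{R}^2$ with $\mathcal{S}\setminus\{\boldsymbol{0}\}\ne\emptyset$: the direction vector set is $\mathrm{dv}_{\mathcal{S}}=\{(\cos\theta,\sin\theta):\ \boldsymbol{0}\neq\boldsymbol{x}=\|\boldsymbol{x}\|_2(\cos\theta,\sin\theta)^T\in\mathcal{S}\}$, and the null set is $\mathcal{N}_{\mathcal{S}}=\{\boldsymbol{0}\ne\boldsymbol{y}\in\mathbb{R}^2:\text{there is }\boldsymbol{0}\neq\boldsymbol{x}\in\mathcal{S}\text{ with }\boldsymbol{x}^T\boldsymbol{y}=0\}$. For $\mathcal{S}=\emptyset$ or $\{\boldsymbol{0}\}$, both sets are defined to be $\emptyset$. Standing convention: a target function $f\in V(\varphi,\mathbb{Z}^2)$ with $\operatorname{supp}(f)\subseteq[a_1,b_1]\times[a_2,b_2]$ is one expressed as $f=\sum_{\boldsymbol{k}\in E}c_{\boldsymbol{k}}\varphi(\cdot-\boldsymbol{k})$ with $c_{\boldsymbol{k}}\in\mathbb{C}$. ''$f$ can be determined uniquely by its single-angle Radon samples at $X$'' means that $f$ is the only function $h$ of the form $\sum_{\boldsymbol{k}\in E}d_{\boldsymbol{k}}\varphi(\cdot-\boldsymbol{k})$, $d_{\boldsymbol{k}}\in\mathbb{C}$, with $\mathcal{R}_{\boldsymbol{p}}h(x)=\mathcal{R}_{\boldsymbol{p}}f(x)$ for all $x\in X$. *)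

(* Defs.v *)
From HB Require Import structures.
From mathcomp Require Import all_boot all_order all_algebra.
From mathcomp Require Import all_classical all_reals all_analysis.
From mathcomp Require Import complex.

Set Implicit Arguments.
Unset Strict Implicit.
Unset Printing Implicit Defensive.

Import Order.TTheory GRing.Theory Num.Theory.
Import numFieldNormedType.Exports.

Local Open Scope classical_set_scope.
Local Open Scope ring_scope.
Local Open Scope complex_scope.

Section Plane.
Context {R : realType}.
Implicit Types (x y p : R * R) (k : int * int).

Definition dotp x y : R := x.1 * y.1 + x.2 * y.2.

(* The library norm on a product is the sup norm. *)
Definition norm2 x : R := Num.sqrt (x.1 ^+ 2 + x.2 ^+ 2).

Definition intpt k : R * R := (k.1%:~R, k.2%:~R).

Definition dir (theta : R) : R * R := (cos theta, sin theta).

Definition directions : set (R * R) := [set dir theta | theta in `[0, 2 * pi[].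

Definition rectangle (a b : R * R) : set (R * R) :=
  [set x | (a.1 <= x.1 <= b.1) && (a.2 <= x.2 <= b.2)].

Definition dv (S : set (R * R)) : set (R * R) :=
  [set p | exists x theta,
     [/\ S x, x != 0, x = norm2 x *: dir theta & p = dir theta]].

Definition null_vectors (S : set (R * R)) : set (R * R) :=
  [set y | y != 0 /\ exists x, [/\ S x, x != 0 & dotp x y = 0]].

Definition index_set (N M a b : R * R) : set (int * int) :=
  [set k | (Num.ceil (a.1 - M.1) <= k.1 <= Num.floor (b.1 - N.1)) &&
           (Num.ceil (a.2 - M.2) <= k.2 <= Num.floor (b.2 - N.2))].

Definition differences (E : set (int * int)) : set (R * R) :=
  [set z | exists k l, [/\ E k, E l, k != l & z = intpt k - intpt l]].

End Plane.

Section ComplexFunctions.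
Context {R : realType}.
Implicit Types (f g phi : R * R -> R[i]).

Definition leb2 := (@lebesgue_measure R \x @lebesgue_measure R)%E.

Definition cintegral d (T : measurableType d)
    (mu : {measure set T -> \bar R}) (F : T -> R[i]) : R[i] :=
  (\int[mu]_x complex.Re (F x)) +i* (\int[mu]_x complex.Im (F x)).

Definition expNi (t : R) : R[i] := cos t -i* sin t.

Definition fourier g (xi : R * R) : R[i] :=
  cintegral leb2 (fun x => g x * expNi (dotp x xi)).

(* Line integral over {t p + s p^perp : s real}, for p = (cos theta, sin theta). *)
Definition radon (p : R * R) f (t : R) : R[i] :=
  cintegral (@lebesgue_measure R)
    (fun s => f (t * p.1 - s * p.2, t * p.2 + s * p.1)).

Definition in_sobolev (s : R) g : Prop :=
  (\int[leb2]_xi ((ComplexField.Normc.normc (fourier g xi) ^+ 2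
                   * (1 + norm2 xi ^+ 2) `^ s)%:E) < +oo)%E.

Definition nu2 g : \bar R := ereal_sup [set s%:E | s in [set s | in_sobolev s g]].

(* [0 < z] in R[i] means that z is real and positive. *)
Definition positive_definite phi : Prop :=
  forall (N : nat) (x : 'I_N -> R * R) (alpha : 'I_N -> R[i]),
    injective x -> (exists j, alpha j != 0) ->
    0 < \sum_(j < N) \sum_(k < N) alpha j * (alpha k)^* * phi (x j - x k).

Definition supp f : set (R * R) := closure [set x | f x != 0].

Definition lincomb phi (E : set (int * int)) (c : int * int -> R[i]) :
    R * R -> R[i] :=
  fun x => \sum_(k \in E) c k * phi (x - intpt k).

Definition in_span phi (E : set (int * int)) f : Prop :=
  exists c, f = lincomb phi E c.

(* For compactly supported [phi] the series is, at each point, a finite sum,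
   so [lincomb phi setT c] is its value; for other [phi] this definition is
   not the intended one, as a finitely supported sum with infinite support is
   zero by convention. *)
Definition in_V phi f : Prop :=
  exists c : int * int -> R[i],
    (\esum_(k in [set: int * int]) (ComplexField.Normc.normc (c k) ^+ 2)%:E < +oo)%E /\
    f = lincomb phi [set: int * int] c.

Definition shifts_independent phi : Prop :=
  forall (A : set (int * int)) (c : int * int -> R[i]),
    finite_set A ->
    {ae leb2, forall x, lincomb phi A c x = 0} ->
    forall k, A k -> c k = 0.

Definition determined_by_radon_samples phi (E : set (int * int)) (p : R * R)
    (X : set R) f : Prop :=
  forall h, in_span phi E h ->
    (forall t, X t -> radon p h t = radon p f t) -> h = f.

End ComplexFunctions.

(* Main.v *)
Require Import Defs.
From mathcomp Require Import all_boot all_order all_algebra finmap.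
From mathcomp Require Import all_classical all_reals all_analysis.
From mathcomp Require Import measurable_realfun complex.
From mathcomp Require Import ring lra zify.
Import Order.TTheory GRing.Theory Num.Theory.
Import numFieldNormedType.Exports.
Local Open Scope classical_set_scope.
Local Open Scope ring_scope.

Set Implicit Arguments.
Unset Strict Implicit.
Unset Printing Implicit Defensive.

(** No Fourier analysis is needed.  Put [psi t := radon p phi t]; if two
    combinations of the shifts have the same samples, the difference [e] of
    their coefficients satisfies [sum_k e_k psi (t_j - t_k) = 0] for all [j],
    where [t_k = p k], and the [t_k] are distinct because [p] avoids the
    directions orthogonal to differences of indices.  The function [psi] is
    positive semidefinite: apply the positive definiteness of [phi] on the grids
    [{t_j p + (i / m) p^perp}] and pass from averaged sums to Riemann sums, then
    to integrals.  By Cauchy-Schwarz the vector [e] then annihilates everything: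
    [sum_k e_k psi (x - t_k) = 0] for every real [x].  But finitely many distinct
    translates of a nonzero boundedly supported function are linearly
    independent, so [e = 0].  Finally [psi] is not identically zero, as otherwise
    [fourier phi 0], the integral of [phi], would vanish by Fubini. *)

(** * Positive semidefinite functions *)

Lemma ReD (R : realType) (x y : R[i]) :
  complex.Re (x + y) = complex.Re x + complex.Re y.
Proof. by case: x y => ? ? []. Qed.

Lemma ImD (R : realType) (x y : R[i]) :
  complex.Im (x + y) = complex.Im x + complex.Im y.
Proof. by case: x y => ? ? []. Qed.

Lemma ReM (R : realType) (x y : R[i]) : complex.Re (x * y) =
  complex.Re x * complex.Re y - complex.Im x * complex.Im y.
Proof. by case: x y => ? ? []. Qed.

Lemma ImM (R : realType) (x y : R[i]) : complex.Im (x * y) =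
  complex.Re x * complex.Im y + complex.Im x * complex.Re y.
Proof. by case: x y => ? ? []. Qed.

Definition Re_sum (R : realType) I r (P : pred I) F :=
  @big_morph _ _ _ _ _ _ _ (@ReD R) (erefl _ : complex.Re 0 = 0) I r P F.

Definition Im_sum (R : realType) I r (P : pred I) F :=
  @big_morph _ _ _ _ _ _ _ (@ImD R) (erefl _ : complex.Im 0 = 0) I r P F.

(** By the Archimedean property, a negative step would eventually outweigh the initial term [q]. *)
Lemma ge0_arith_progression (R : realType) (q s : R) :
  (forall n : nat, 0 <= q + s *+ n) -> 0 <= s.
Proof.
move=> H; rewrite leNgt; apply/negP => s0.
have := archi_boundP (normr_ge0 (q / s)).
set n := Num.bound _ => nP; have := H n; apply/negP; rewrite -ltNge.
have : q <= `|q / s| * - s.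
  by rewrite normrM normfV (ltr0_norm s0) mulfVK ?ler_norm// oppr_eq0 ltr0_neq0.
rewrite -mulr_natr.
have : `|q / s| * - s < n%:R * - s by rewrite ltr_pM2r// oppr_gt0.
lra.
Qed.

Lemma ge0_arith_progressionC (R : realType) (q s : R[i]) :
  (forall n : nat, 0 <= q + s *+ n) -> 0 <= s.
Proof.
have MnE (F : R[i] -> R) (FD : {morph F : x y / x + y}) (F0 : F 0 = 0) n :
    F (q + s *+ n) = F q + F s *+ n.
  by rewrite FD; congr +%R; elim: n => [|n IH]; rewrite ?mulr0n// !mulrS FD IH.
move=> H; rewrite lecE; apply/andP; split.
  have := H 0%N; have := H 1%N.
  rewrite !lecE !(MnE _ (@ImD R))//= mulr0n mulr1n addr0.
  by move=> /andP[/eqP i1 _] /andP[/eqP i0 _]; apply/eqP; lra.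
apply: (@ge0_arith_progression _ (complex.Re q)) => n.
by have := H n; rewrite lecE !(MnE _ (@ReD R))// => /andP[_].
Qed.

(* The sum over the [n.+1] by [n.+1] square exceeds the one over the [n] by [n]
   square by the sum of [a] over [-n, n]. *)
Lemma toeplitz_sum_ge0 (R : realType) (a : int -> R[i]) (K : nat) :
  (forall r : int, (K <= `|r|)%N -> a r = 0) ->
  (forall n, 0 <= \sum_(i < n) \sum_(j < n) a (i%:Z - j%:Z)) ->
  0 <= \sum_(i < K + K) a (i%:Z - K%:Z).
Proof.
move=> a0 pos.
pose s n := a 0 + \sum_(i < n) (a i.+1%:Z + a (- i.+1%:Z)).
pose Q n := \sum_(i < n) \sum_(j < n) a (i%:Z - j%:Z).
have QS n : Q n.+1 = Q n + s n.
  rewrite /Q big_ord_recr /= big_ord_recr /= subrr.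
  under eq_bigr do rewrite big_ord_recr /=.
  rewrite big_split/= /s big_split/= -!addrA; congr +%R.
  rewrite addrCA [RHS]addrC addrA; congr (_ + _).
  congr +%R; rewrite (reindex_inj rev_ord_inj)/=;
    apply: eq_bigr => i _; congr a; have := ltn_ord i; lia.
(* As [a] vanishes from distance [K] on, the increments of [Q] are constant from there on. So [Q]
   becomes an arithmetic progression with step [s K]. *)
have sK n : s (K + n)%N = s K.
  rewrite /s big_split_ord/= [X in _ + (_ + X)]big1 ?addr0// => i _.
  by rewrite !a0 ?addr0//; lia.
have QK n : Q (K + n)%N = Q K + s K *+ n.
  elim: n => [|n IH]; first by rewrite addn0 mulr0n addr0.
  by rewrite addnS QS IH sK mulrSr -addrA.
(* The left side runs over [-K, K - 1] and [s K] over [-K, K]; the extra value [a K] is zero. *)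
suff -> : \sum_(i < K + K) a (i%:Z - K%:Z) = s K.
  apply: (@ge0_arith_progressionC _ (Q K)) => n; rewrite -QK; exact: pos.
rewrite big_split_ord/= /s big_split/= addrA [RHS]addrC; congr +%R.
  rewrite (reindex_inj rev_ord_inj)/=; apply: eq_bigr => i _; congr a.
  have := ltn_ord i; lia.
have aK : a K = 0 by apply: a0; lia.
have -> : a 0 + \sum_(i < K) a i.+1%:Z = \sum_(i < K.+1) a i%:Z by rewrite big_ord_recl.
rewrite big_ord_recr/= aK addr0; apply: eq_bigr => i _; congr a; lia.
Qed.

(** The weak inequality admits zero weights, and a general finite index type makes it possible to
    index grids by products. *)
Lemma positive_definite_finType (R : realType) (phi : R * R -> R[i])
    (T : finType) (x : T -> R * R) (alpha : T -> R[i]) :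
  positive_definite phi -> injective x ->
  0 <= \sum_j \sum_k alpha j * (alpha k)^*%C * phi (x j - x k).
Proof.
move=> pd xinj.
have [[j aj0]|a0] := pselect (exists j, alpha j != 0).
  apply/ltW; rewrite (reindex (@enum_val T T)) /=; last first.
    by apply: onW_bij; exact: enum_val_bij.
  under eq_bigr => i _.
    rewrite (reindex (@enum_val T T)) /=; last first.
      by apply: onW_bij; exact: enum_val_bij.
    over.
  apply: (pd _ (x \o enum_val) (alpha \o enum_val)).
    by apply: inj_comp => //; exact: enum_val_inj.
  by exists (enum_rank j); rewrite /= enum_rankK.
rewrite big1// => j _; rewrite big1// => k _.
suff -> : alpha j = 0 by rewrite !mul0r.
by apply/eqP/negPn/negP => aj; apply: a0; exists j.
Qed.

(** Quantifying over finite types lets one more point be adjoined through [option]. *)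
Definition semidefinite (R : realType) (psi : R -> R[i]) :=
  forall (T : finType) (x : T -> R) (alpha : T -> R[i]), injective x ->
  0 <= \sum_j \sum_k alpha j * (alpha k)^*%C * psi (x j - x k).

(** For small [l] the linear terms dominate. The imaginary parts at [l] = 1, -1, i, -i show that [v]
    is the conjugate of [u] and that [w] is real. Taking [l] to be [- e] times the conjugate of [u]
    then gives a negative value for small [e > 0], unless [u = 0]. *)
Lemma cross_term_eq0 (R : realType) (u v w : R[i]) :
  (forall l : R[i], 0 <= l * u + l^*%C * v + l * l^*%C * w) -> u = 0.
Proof.
case: u v w => [u1 u2] [v1 v2] [w1 w2] H.
have := H (Complex 1 0); have := H (Complex (-1) 0); have := H (Complex 0 1).
have := H (Complex 0 (-1)).
rewrite !lecE /= => /andP[/eqP e1 _] /andP[/eqP e2 _] /andP[/eqP e3 _] /andP[/eqP e4 _].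
have v1E : v1 = u1 by lra.
have v2E : v2 = - u2 by lra.
have w2E : w2 = 0 by lra.
subst v1 v2 w2.
pose n := u1 ^+ 2 + u2 ^+ 2.
have n0 : 0 <= n by rewrite addr_ge0// sqr_ge0.
have K (e : R) : 0 <= e * (e * w1 - 2) * n.
  have := H (Complex (- e * u1) (e * u2)); rewrite lecE /= => /andP[_].
  by congr (_ <= _); rewrite /n; ring.
suff : n = 0.
  move=> /eqP; rewrite paddr_eq0 ?sqr_ge0// !sqrf_eq0.
  by move=> /andP[/eqP -> /eqP ->].
apply/eqP; rewrite eq_le n0 andbT leNgt; apply/negP => np.
(* With this [e] one has [e * w1 < 2], and the denominator is never zero. *)
have := K (1 / (1 + `|w1|)); rewrite pmulr_lge0//; apply/negP; rewrite -ltNge.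
have wp : 0 < 1 + `|w1| by have := normr_ge0 w1; lra.
rewrite pmulr_rlt0 ?divr_gt0// subr_lt0 mulrAC mul1r ltr_pdivrMr//.
by have := ler_norm w1; lra.
Qed.

(** This is the Cauchy-Schwarz argument: adjoin the point [x] with a free weight [l]. The part of
    the form that involves only the [t j] vanishes, so the coefficient of [l], which is the sum in
    question, must vanish as well. *)
Lemma semidefinite_kernel (R : realType) (psi : R -> R[i])
    (J : finType) (t : J -> R) (e : J -> R[i]) :
  semidefinite psi -> injective t ->
  (forall j, \sum_k e k * psi (t j - t k) = 0) ->
  forall x, \sum_k e k * psi (x - t k) = 0.
Proof.
move=> sd tinj e0 x.
have [[j <-//]|xt] := pselect (exists j, t j = x).
set v := \sum_j (e j)^*%C * psi (t j - x).
apply: (@cross_term_eq0 _ _ v (psi 0)) => l.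
pose y (o : option J) := if o is Some j then t j else x.
(* The form conjugates its second weight, so the conjugates of [e] are used to make [e] itself
   appear there. *)
pose al (o : option J) := if o is Some j then (e j)^*%C else l.
have yinj : injective y.
  move=> [i|] [j|] //= ; first by move=> /tinj ->.
    by move=> ij; case: xt; exists i.
  by move=> ij; case: xt; exists j.
have := sd _ y al yinj.
have splitO (F : option J -> R[i]) : \sum_o F o = F None + \sum_j F (Some j).
  rewrite (bigD1 None)//=; congr +%R.
  rewrite (reindex_omap Some id)/=; last by case.
  by apply: eq_bigl => j; rewrite eqxx.
rewrite splitO splitO /= subrr.
under [X in _ + X]eq_bigr => j _.
  rewrite splitO/=.
  under eq_bigr => k _ do rewrite conjcK -mulrA.
  rewrite -mulr_sumr e0 mulr0 addr0 [_ * l^*%C]mulrC -mulrA.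
  over.
rewrite -mulr_sumr.
under eq_bigr => k _ do rewrite conjcK -mulrA.
rewrite -mulr_sumr -/v; congr (_ <= _); ring.
Qed.

(** Among the translates with nonzero coefficient, the rightmost one takes a nonzero value to the
    right of the supports of all the others. *)
Lemma translates_independent (R : realType) (psi : R -> R[i]) (A : R)
    (J : finType) (t : J -> R) (e : J -> R[i]) :
  (forall x, psi x != 0 -> `|x| <= A) -> (exists x, psi x != 0) ->
  injective t ->
  (forall x, \sum_k e k * psi (x - t k) = 0) -> forall k, e k = 0.
Proof.
move=> psiA [x0 px0] tinj e0 k1.
apply/eqP/negPn/negP => ek1.
have [k0 /= ek0 k0max] := @Order.TotalTheory.arg_maxP _ R J k1 (fun k => e k != 0) t ek1.
pose S := [set x | psi x != 0].
have hS : has_sup S.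
  split; first by exists x0.
  by exists A => x /= /psiA; rewrite ler_norml => /andP[].
have [d d0 dP] : exists2 d : R, 0 < d & forall k, e k != 0 -> k != k0 -> d <= t k0 - t k.
  have tk k : e k != 0 -> k != k0 -> 0 < t k0 - t k.
    move=> ek kk0; rewrite subr_gt0 lt_neqAle k0max// andbT.
    by apply: contra_neq kk0 => /tinj.
  (* The default 1 keeps the gap positive when [k0] is the only index with a nonzero coefficient. *)
  exists (\big[Order.min/1]_(k | (e k != 0) && (k != k0)) (t k0 - t k)).
    apply: (big_ind (fun z : R => 0 < z)) => //; first by move=> a b a0 b0; rewrite lt_min a0.
    by move=> k /andP[]; exact: tk.
  by move=> k ek kk0; apply: bigmin_le_cond; rewrite ek.
(* At [y + t k0] every other active translate is evaluated at [y + d] or further right, hence beyond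
   the supremum of [S]. *)
have [y Sy ysup] := sup_adherent d0 hS.
have := e0 (y + t k0).
rewrite (bigD1 k0)//= addrK big1 ?addr0; last first.
  move=> k kk0; have [->|ek] := eqVneq (e k) 0; first by rewrite mul0r.
  suff -> : psi (y + t k0 - t k) = 0 by rewrite mulr0.
  apply/eqP/negPn/negP => /(ub_le_sup hS.2); apply/negP; rewrite -ltNge.
  by have := dP _ ek kk0; lra.
by move/eqP; rewrite mulf_eq0 (negbTE ek0)/= => /negPn/negP; apply.
Qed.

(** * Integrals of continuous functions with bounded support *)

Section one_dim.
Context {R : realType}.
Notation mu := (@lebesgue_measure R).
Implicit Types F G : R -> R.

Lemma integrable_continuous_bounded_support F (A : R) : continuous F ->
  (forall x, F x != 0 -> `|x| <= A) -> mu.-integrable setT (EFin \o F).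
Proof.
move=> cF FA.
have -> : EFin \o F = (EFin \o F) \_ `[- A, A].
  apply/funext => x; rewrite patchE; case: ifPn => // /negP xA.
  congr EFin; apply/eqP/negPn/negP => /FA; rewrite ler_norml => xA'.
  by apply: xA; rewrite inE /= in_itv.
apply: (proj1 (integrable_mkcond _ _)) => //.
apply: continuous_compact_integrable; first exact: segment_compact.
exact: continuous_subspaceT.
Qed.

Lemma Rintegral_bounded_support F (A : R) :
  (forall x, F x != 0 -> `|x| <= A) ->
  \int[mu]_x F x = \int[mu]_(x in `[- A, A]) F x.
Proof.
move=> FA; rewrite [RHS]Rintegral_mkcond; apply: eq_Rintegral => x _.
rewrite patchE; case: ifPn => // /negP xA.
apply/eqP/negPn/negP => /FA; rewrite ler_norml => xA'.
by apply: xA; rewrite inE /= in_itv.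
Qed.

Lemma measurable_affine (a b : R) :
  measurable_fun setT (fun x : measurableTypeR R => a * x + b : measurableTypeR R).
Proof.
apply: continuous_measurable_fun => x; apply: cvgD; last exact: cvg_cst.
by apply: cvgM => //; exact: cvg_cst.
Qed.

(** By uniqueness of Lebesgue measure it suffices to compare on half-open intervals. For negative
    [a] their preimages are closed on the left instead of the right, which does not affect the
    length. *)
Lemma lebesgue_measure_affine (a b : R) (D : set (measurableTypeR R)) :
  a != 0 -> measurable D ->
  (`|a|%:E * mu [set x | D (a * x + b)%R] = mu D)%E.
Proof.
move=> a0 mD; have na : 0 < `|a| by rewrite normr_gt0.
pose k := NngNum (normr_ge0 a).
have := @lebesgue_measure_unique R
  (mscale k (pushforward mu (fun x : measurableTypeR R => a * x + b : measurableTypeR R))).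
move=> /(_ (measurable_affine a b)) muE; rewrite [RHS]muE//.
move=> _ [[x y] _ <-] /=; rewrite lebesgue_measure_itv/=.
transitivity (`|a|%:E * mu ((fun t => a * t + b)%R @^-1` `]x, y]%classic))%E; last by [].
have aE z t : (z < a * t + b) = (z - b < t * a) by rewrite ltrBlDr [t * a]mulrC.
have aE' z t : (a * t + b <= z) = (t * a <= z - b) by rewrite lerBrDr [t * a]mulrC.
case: (ltrgtP a 0) a0 => // sa _.
  have -> : (fun t => a * t + b) @^-1` `]x, y] = `[(y - b) / a, (x - b) / a[%classic.
    apply/seteqP; split => z /=; rewrite !in_itv/= aE aE'.
      by move=> /andP[*]; rewrite ler_ndivrMr// ltr_ndivlMr//; apply/andP.
    by rewrite ler_ndivrMr// ltr_ndivlMr// => /andP[*]; apply/andP.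
  rewrite lebesgue_measure_itv/= !lte_fin ltr_ndivrMr// divfK ?lt_eqF// ltrD2r.
  case: ifPn => xy; last by rewrite mule0.
  rewrite -!EFinD -EFinM; congr EFin; rewrite ltr0_norm//; field.
  by rewrite lt_eqF.
have -> : (fun t => a * t + b) @^-1` `]x, y] = `](x - b) / a, (y - b) / a]%classic.
  apply/seteqP; split => z /=; rewrite !in_itv/= aE aE'.
    by move=> /andP[*]; rewrite ltr_pdivrMr// ler_pdivlMr//; apply/andP.
  by rewrite ltr_pdivrMr// ler_pdivlMr// => /andP[*]; apply/andP.
rewrite lebesgue_measure_itv/= !lte_fin ltr_pdivrMr// divfK ?gt_eqF// ltrD2r.
case: ifPn => xy; last by rewrite mule0.
rewrite -!EFinD -EFinM; congr EFin; rewrite gtr0_norm//; field.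
by rewrite gt_eqF.
Qed.

Lemma ge0_integral_affine (a b : R) (f : R -> \bar R) : a != 0 ->
  measurable_fun setT f -> (forall x, 0 <= f x)%E ->
  (\int[mu]_x f x = `|a|%:E * \int[mu]_x f (a * x + b)%R)%E.
Proof.
move=> a0 mf f0.
pose k := NngNum (normr_ge0 a).
have <- := @ge0_integral_pushforward _ _ _ _ R _ (measurable_affine a b) mu setT f
  measurableT mf (fun y _ => f0 y).
rewrite -(@ge0_integral_mscale _ _ _ _ _ measurableT k)//.
  exact: measurable_affine.
move=> maff; apply: eq_measure_integral => D mD _.
exact/esym/lebesgue_measure_affine.
Qed.

(** Positive and negative parts are transformed separately; integrability makes both integrals
    finite, so that the factor can be taken out of their difference. *)
Lemma Rintegral_affine (a b : R) F : a != 0 -> measurable_fun setT F ->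
  mu.-integrable setT (EFin \o (fun x => F (a * x + b))) ->
  \int[mu]_x F x = `|a| * \int[mu]_x F (a * x + b).
Proof.
move=> a0 mF iF; have mEF : measurable_fun setT (EFin \o F) by exact/measurable_EFinP.
rewrite /Rintegral integralE.
rewrite (ge0_integral_affine b a0 (measurable_funepos mEF))//.
rewrite (ge0_integral_affine b a0 (measurable_funeneg mEF))//.
set G := EFin \o (fun x => F (a * x + b)) in iF.
have -> : (\int[mu]_x (EFin \o F)^\+ (a * x + b)%R = \int[mu]_x G^\+ x)%E.
  by apply: eq_integral => x _; rewrite (funepos_comp (EFin \o F) (fun x => a * x + b)).
have -> : (\int[mu]_x (EFin \o F)^\- (a * x + b)%R = \int[mu]_x G^\- x)%E.
  by apply: eq_integral => x _; rewrite (funeneg_comp (EFin \o F) (fun x => a * x + b)).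
have pG := integrable_pos_fin_num measurableT iF.
have nG := integrable_neg_fin_num measurableT iF.
rewrite -muleBr//; last by apply: fin_num_adde_defl; rewrite fin_numN.
rewrite fineM//; last by rewrite fin_numB pG nG.
by congr (_ * fine _); rewrite [RHS]integralE.
Qed.

End one_dim.

(** * Lower Riemann sums of continuous functions *)

Section riemann.
Context {R : realType}.
Notation mu := (@lebesgue_measure R).
Implicit Types F G : R -> R.

(** Compactness in its near-covering form, with radii tending to 0 from the right, turns local radii
    of continuity into a common one. Only [x] is confined to the segment. *)
Lemma uniform_continuity_segment F (a b e : R) : continuous F -> 0 < e ->
  exists2 d : R, 0 < d & forall x y, a <= x <= b -> `|x - y| < d ->
    `|F x - F y| < e.
Proof.
move=> cF e0.
have := @segment_compact R a b; rewrite compact_near_coveringP.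
move=> /(_ R (0:R)^'+ (fun d x => forall y, `|x - y| < d -> `|F x - F y| < e) _) [].
  move=> x _.
  have /cvgrPdist_lt /(_ _ (divr_gt0 e0 (ltr0Sn R 1))) := cF x.
  move=> /nbhs_ballP [r /= r0 Hr].
  have r2 : 0 < r / 2 by rewrite divr_gt0.
  near=> z d => /= y zy.
  have zx : `|x - z| < r / 2.
    by near: z; apply/nbhs_ballP; exists (r / 2).
  have dr : d < r / 2 by near: d; exact: nbhs_right_lt.
  have Fz : `|F x - F z| < e / 2 by apply: Hr; rewrite /ball/=; lra.
  have Fy : `|F x - F y| < e / 2.
    apply: Hr; rewrite /ball/= (_ : x - y = (x - z) + (z - y)); last by ring.
    by rewrite (le_lt_trans (ler_normD _ _))//; lra.
  rewrite (_ : F z - F y = (F x - F y) - (F x - F z)); last by ring.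
  by rewrite (le_lt_trans (ler_normB _ _))//; lra.
move=> d /= d0 Hd; exists (d / 2); first by rewrite divr_gt0.
move=> x y axb xy; apply: (Hd (d / 2)) => //=.
- rewrite /ball/= sub0r normrN gtr0_norm; lra.
by rewrite divr_gt0.
Unshelve. all: by end_near. Qed.

Lemma lower_riemann_sum F (a h e : R) (n : nat) : continuous F -> 0 <= h ->
  (forall (i : nat) x, (i < n)%N -> a + i%:R * h <= x <= a + i.+1%:R * h ->
     F (a + i%:R * h) - e <= F x) ->
  \sum_(i < n) (F (a + i%:R * h) - e) * h <= \int[mu]_(x in `[a, a + n%:R * h]) F x.
Proof.
move=> cF h0; elim: n => [|n IH] H.
  by rewrite big_ord0 mul0r addr0 set_itv1 Rintegral_set1.
have iF x y : mu.-integrable `[x, y] (EFin \o F).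
  apply: continuous_compact_integrable; first exact: segment_compact.
  exact: continuous_subspaceT.
have nh : 0 <= n%:R * h by rewrite mulr_ge0.
have Sh : n.+1%:R * h = n%:R * h + h by rewrite -natr1 mulrDl mul1r.
rewrite big_ord_recr/=.
have /eqP : \int[mu]_(x in `[a, a + n.+1%:R * h]) F x -
    \int[mu]_(x in `[a, a + n%:R * h]) F x =
    \int[mu]_(x in `]a + n%:R * h, a + n.+1%:R * h]) F x.
  by rewrite Rintegral_itvB//; rewrite bnd_simp; lra.
rewrite subr_eq => /eqP ->.
rewrite addrC; apply: lerD; last first.
  by apply: IH => i x ni; apply: H; rewrite ltnS ltnW.
rewrite Rintegral_itv_obnd_cbnd//; last first.
  by apply: integrableS (iF _ _) => //; exact: subset_itv_oc_cc.
apply: (@le_trans _ _ (\int[mu]_(x in `[(a + n%:R * h), (a + n.+1%:R * h)]) (F (a + n%:R * h) - e))).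
  rewrite Rintegral_cst//.
  have := @lebesgue_measure_itv R `[a + n%:R * h, a + n.+1%:R * h].
  rewrite /= lte_fin -EFinB => ->.
  have -> : a + n.+1%:R * h - (a + n%:R * h) = h by rewrite Sh; ring.
  (* The remaining case is a cell reduced to a point, where both sides are zero. *)
  case: ifPn => //=; rewrite -leNgt Sh => ?; have -> : h = 0 by lra.
  by rewrite !mulr0.
apply: le_Rintegral => //.
  apply: continuous_compact_integrable; first exact: segment_compact.
  by apply: continuous_subspaceT => ?; exact: cvg_cst.
by move=> x; rewrite /= in_itv/= => hx; apply: H.
Qed.

(** On a fine enough grid of [-A, A], the integral exceeds the Riemann sum minus [e], for any given
    [e > 0]. *)
Lemma Rintegral_ge0_riemann F (A : nat) : continuous F ->
  (forall x, F x != 0 -> `|x| <= A%:R) ->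
  (forall m : nat, 0 <= \sum_(i < A * m.+1 + A * m.+1)
     F ((i%:Z - (A * m.+1)%N%:Z)%:~R / m.+1%:R)) ->
  0 <= \int[mu]_x F x.
Proof.
move=> cF FA Fsum.
apply/ler_addgt0Pl => e e0; rewrite -lerBlDl sub0r.
rewrite (Rintegral_bounded_support FA).
(* The error per unit length: over the length [A + A] it adds up to [e - e']. The 1 keeps the
   denominator positive when [A = 0]. *)
pose e' : R := e / (1 + A%:R + A%:R).
have A0 : 0 <= A%:R :> R by [].
have e'0 : 0 < e' by rewrite divr_gt0//; lra.
have [d d0 dP] := uniform_continuity_segment (- A%:R) A%:R cF e'0.
have [m md] : exists m : nat, m.+1%:R^-1 < d.
  exists (Num.bound d^-1); rewrite invf_plt ?posrE//.
  rewrite (lt_le_trans (archi_boundP _)) ?ler_nat//.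
  by rewrite invr_ge0 ltW.
set h : R := m.+1%:R^-1 in md.
have h0 : 0 < h by rewrite invr_gt0.
have mh : m.+1%:R * h = 1 by rewrite divff.
pose n := (A * m.+1 + A * m.+1)%N.
have nh : n%:R * h = A%:R + A%:R by rewrite natrD mulrDl natrM -mulrA mh mulr1.
have L := @lower_riemann_sum F (- A%:R) h e' n cF (ltW h0).
rewrite nh addKr in L; apply: le_trans (L _); last first.
  move=> i x ni /andP[x1 x2].
  have iS : i.+1%:R * h = i%:R * h + h by rewrite -natr1 mulrDl mul1r.
  have i0 : 0 <= i%:R * h by rewrite mulr_ge0// ltW.
  have iA : i.+1%:R * h <= A%:R + A%:R by rewrite -nh ler_pM2r// ler_nat.
  have xx : `|- A%:R + i%:R * h - x| <= h by rewrite ler_norml; apply/andP; split; lra.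
  have : `|F (- A%:R + i%:R * h) - F x| < e'.
    by apply: dP; [apply/andP; split; lra|exact: le_lt_trans xx md].
  rewrite ltr_norml => /andP[]; lra.
rewrite -mulr_suml sumrB sumr_const card_ord -[e' *+ _]mulr_natr mulrBl -[X in _ - X]mulrA nh.
have -> : e' * (A%:R + A%:R) = e - e'.
  have AA : 1 + A%:R + A%:R != 0 :> R by rewrite gt_eqF//; lra.
  by rewrite /e'; field.
have : 0 <= (\sum_(i < n) F (- A%:R + i%:R * h)) * h; last lra.
rewrite mulr_ge0//; last exact: ltW.
apply: le_trans (Fsum m) _; rewrite le_eqVlt; apply/orP; left; apply/eqP.
apply: eq_bigr => i _; congr F.
rewrite rmorphB/= mulrBl addrC; congr (_ + _).
by rewrite -pmulrn natrM -mulrA mh mulr1.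
Qed.

End riemann.

(** * Fubini and integration along parallel lines in the plane *)

Section two_dim.
Context {R : realType}.
Notation mu := (@lebesgue_measure R).
Implicit Types u : R * R -> R.

(** An open set is the countable union of the squares with rational centre and radius that it
    contains, and these squares are measurable rectangles. *)
Lemma open_measurable_prod (O : set (R * R)) : open O ->
  measurable (O : set (measurableTypeR R * measurableTypeR R)).
Proof.
move=> oO.
pose B (q : rat * rat * rat) : set (R * R) :=
  ball (ratr q.1.1 : R) (ratr q.2 : R) `*` ball (ratr q.1.2 : R) (ratr q.2 : R).
have -> : O = \bigcup_(q : rat * rat * rat) (if `[< B q `<=` O >] then B q else set0).
  apply/seteqP; split => [[x y] Oxy|[x y] [q _]]; last first.
    by case: asboolP => // h /h.
  have [e /= e0 eO] : nbhs_ball (x, y) O.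
    by apply/nbhs_ballP; move: oO; rewrite openE => /(_ _ Oxy).
  have [r /andP[r0 re]] : exists r : rat, (0 < (ratr r : R) < e / 2).
    have [|r] := @rat_in_itvoo R 0 (e / 2); first by rewrite divr_gt0.
    by rewrite in_itv/=; exists r.
  have rat_near (z : R) : exists q : rat, `|ratr q - z| < ratr r :> R.
    have [|q] := @rat_in_itvoo R (z - ratr r) (z + ratr r); first by lra.
    rewrite in_itv/= => /andP[? ?]; exists q.
    by rewrite ltr_norml; apply/andP; split; lra.
  have [p px] := rat_near x; have [q qy] := rat_near y.
  exists ((p, q), r) => //=; rewrite asboolT//.
  move=> [x' y'] [/= hx hy]; apply: eO; split; rewrite /ball/=.
    rewrite (_ : x - x' = (ratr p - x') - (ratr p - x)); last by ring.
    rewrite (le_lt_trans (ler_normB _ _))//; move: hx; rewrite /ball/=; lra.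
  rewrite (_ : y - y' = (ratr q - y') - (ratr q - y)); last by ring.
  rewrite (le_lt_trans (ler_normB _ _))//; move: hy; rewrite /ball/=; lra.
apply: countable_bigcupT_measurable => [|q]; first exact: countableP.
case: asboolP => // _; apply: measurableX; exact: measurable_ball.
Qed.

Lemma continuous_measurable_fun_prod u : continuous u ->
  measurable_fun setT (u : measurableTypeR R * measurableTypeR R -> measurableTypeR R).
Proof.
move=> /continuousP cu; apply: (measurability _ (RGenOpens.measurableE R)).
move=> _ [_ [a [b ->] <-]]; rewrite setTI.
by apply: open_measurable_prod; exact/cu/interval_open.
Qed.

Lemma integrable_continuous_bounded_support2 u (A : R) : continuous u ->
  (forall x, u x != 0 -> `|x.1| <= A /\ `|x.2| <= A) ->
  (mu \x mu)%E.-integrable setT (EFin \o u).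
Proof.
move=> cu uA.
pose I : set R := `[- A, A]%classic.
pose K : set (R * R) := I `*` I.
have mK : measurable (K : set (measurableTypeR R * measurableTypeR R)).
  by apply: measurableX; exact: measurable_itv.
have -> : EFin \o u = (EFin \o u) \_ K.
  apply/funext => x; rewrite patchE; case: ifPn => // /negP xA.
  congr EFin; apply/eqP/negPn/negP => /uA; rewrite !ler_norml => -[x1 x2].
  by apply: xA; rewrite inE /K /I /= !in_itv.
apply: (proj1 (integrable_mkcond _ mK)) => //.
apply: measurable_bounded_integrable => //.
- rewrite [ltLHS](_ : _ = mu I * mu I)%E; last first.
    by apply: product_measure1E; exact: measurable_itv.
  have muA : mu I \is a fin_num.
    by rewrite /I lebesgue_measure_itv/=; case: ifP.
  by rewrite ltey_eq fin_numM.
- apply: measurable_funTS; exact: continuous_measurable_fun_prod.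
have cK : compact K by apply: compact_setX; exact: segment_compact.
have /compact_bounded[M [_ mrt]] : compact (u @` K).
  by apply: continuous_compact => //; exact: continuous_subspaceT.
by exists M; split; rewrite ?num_real // => ? ? ? ?; apply: mrt => //; exists t.
Qed.

Lemma continuous_section1 u (y : R) : continuous u -> continuous (fun x => u (x, y)).
Proof.
by move=> cu x; apply: continuous_comp; [exact: cvg_pair cvg_id (cvg_cst _)|exact: cu].
Qed.

Lemma continuous_section2 u (x : R) : continuous u -> continuous (fun y => u (x, y)).
Proof.
by move=> cu y; apply: continuous_comp; [exact: cvg_pair (cvg_cst _) cvg_id|exact: cu].
Qed.

Lemma Rintegral_prod_xy u (A : R) : continuous u ->
  (forall x, u x != 0 -> `|x.1| <= A /\ `|x.2| <= A) ->
  \int[leb2]_x u x = \int[mu]_x \int[mu]_y u (x, y).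
Proof.
move=> cu uA; rewrite {1}/Rintegral.
rewrite -(integral12_prod_meas1 (integrable_continuous_bounded_support2 cu uA)).
congr fine; apply: eq_integral => x _; rewrite /fubini_F /= fineK//.
apply: integrable_fin_num => //.
apply: (@integrable_continuous_bounded_support _ (fun y => u (x, y)) A).
  exact: continuous_section2.
by move=> y /uA[].
Qed.

Lemma Rintegral_prod_yx u (A : R) : continuous u ->
  (forall x, u x != 0 -> `|x.1| <= A /\ `|x.2| <= A) ->
  \int[leb2]_x u x = \int[mu]_y \int[mu]_x u (x, y).
Proof.
move=> cu uA; rewrite {1}/Rintegral.
rewrite -(integral21_prod_meas1 (integrable_continuous_bounded_support2 cu uA)).
congr fine; apply: eq_integral => y _; rewrite /fubini_G /= fineK//.
apply: integrable_fin_num => //.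
apply: (@integrable_continuous_bounded_support _ (fun x => u (x, y)) A).
  exact: continuous_section1.
by move=> x /uA[].
Qed.

(* The shear [(x, y) |-> (x - y s / c, y)] maps vertical lines to lines in the
   direction [(- s, c)] and preserves the area. *)
Lemma Rintegral_nonhorizontal_lines_eq0 u (A c s : R) : continuous u ->
  (forall x, u x != 0 -> `|x.1| <= A /\ `|x.2| <= A) ->
  c != 0 -> c ^+ 2 + s ^+ 2 = 1 ->
  (forall t, \int[mu]_r u (t * c - r * s, t * s + r * c) = 0) ->
  \int[leb2]_x u x = 0.
Proof.
move=> cu uA c0 cs1 lines0.
pose g (z : R * R) := u (z.1 - z.2 * (s / c), z.2).
have cg : continuous g.
  move=> z; apply: continuous_comp; last exact: cu.
  have c1 : {for z, continuous (fun z : R * R => z.1 - z.2 * (s / c))}.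
    apply: continuousB; first exact: cvg_fst.
    by apply: continuousM; [exact: cvg_snd|exact: cvg_cst].
  exact: cvg_pair c1 cvg_snd.
pose B := A + A * `|s / c|.
have gB z : g z != 0 -> `|z.1| <= B /\ `|z.2| <= B.
  move=> /uA /= [z1 z2].
  have A0 : 0 <= A by exact: le_trans (normr_ge0 _) z2.
  have AB : 0 <= A * `|s / c| by rewrite mulr_ge0.
  have z2B : `|z.2 * (s / c)| <= A * `|s / c| by rewrite normrM ler_wpM2r.
  split; last by rewrite /B; lra.
  rewrite (_ : z.1 = z.1 - z.2 * (s / c) + z.2 * (s / c)); last by ring.
  by rewrite (le_trans (ler_normD _ _))// /B lerD.
rewrite (Rintegral_prod_yx cu uA).
(* On each horizontal line the shear is a translation, so the inner integral is unchanged. *)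
transitivity (\int[mu]_y \int[mu]_x g (x, y)).
  apply: eq_Rintegral => y _.
  rewrite (@Rintegral_affine _ 1 (- (y * (s / c))) (fun x => u (x, y))) ?oner_eq0//.
  - by rewrite normr1 mul1r; apply: eq_Rintegral => x _; rewrite /g/= mul1r.
  - by apply: continuous_measurable_fun; exact: continuous_section1.
  - apply: (@integrable_continuous_bounded_support _ _ B) => x.
      rewrite (_ : (fun _ => _) = (fun x => g (x, y))).
        exact: continuous_section1.
      by apply/funext => z; rewrite /g mul1r.
    by rewrite mul1r => /(gB (x, y))[].
rewrite -(Rintegral_prod_yx cg gB) (Rintegral_prod_xy cg gB).
transitivity (\int[mu]_(x in setT) (0 : R)); last by rewrite Rintegral_cst// mul0r.
apply: eq_Rintegral => x _.
(* The vertical line at [x] is sheared onto the line with parameter [t = x * c]; this affine change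
   of variable matches the two parametrizations. *)
have xE r : g (x, c * r + x * c * s) = u (x * c * c - r * s, x * c * s + r * c).
  rewrite /g /=; congr (u (_, _)); last by ring.
  by rewrite -[X in X - _ = _]mulr1 -cs1; field.
rewrite (@Rintegral_affine _ c (x * c * s) (fun y => g (x, y)))//.
- rewrite (_ : \int[mu]_r _ = 0) ?mulr0// -[RHS](lines0 (x * c)).
  by apply: eq_Rintegral => r _; rewrite xE.
- by apply: continuous_measurable_fun; exact: continuous_section2.
- apply: (@integrable_continuous_bounded_support _ _ ((B + `|x * c * s|) / `|c|)).
    have c1 : continuous (fun r => c * r + x * c * s).
      move=> r; apply: cvgD; last exact: cvg_cst.
      by apply: cvgM => //; exact: cvg_cst.
    move=> r; exact: (continuous_comp (c1 r) (@continuous_section2 g x cg _)).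
  move=> r /gB[_ /= rB]; rewrite ler_pdivlMr ?normr_gt0// -normrM mulrC.
  rewrite (_ : c * r = c * r + x * c * s - x * c * s); last by ring.
  by rewrite (le_trans (ler_normB _ _))// lerD.
Qed.

(** If [c = 0] the lines are horizontal, and exchanging the coordinates makes them vertical. *)
Lemma Rintegral_lines_eq0 u (A c s : R) : continuous u ->
  (forall x, u x != 0 -> `|x.1| <= A /\ `|x.2| <= A) ->
  c ^+ 2 + s ^+ 2 = 1 ->
  (forall t, \int[mu]_r u (t * c - r * s, t * s + r * c) = 0) ->
  \int[leb2]_x u x = 0.
Proof.
move=> cu uA cs1 lines0.
have [c0|c0] := eqVneq c 0; last 
  exact: Rintegral_nonhorizontal_lines_eq0 cu uA c0 cs1 lines0.
pose v z := u (z.2, z.1).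
have cv : continuous v.
  by move=> z; apply: continuous_comp; [exact: cvg_pair cvg_snd cvg_fst|exact: cu].
have vA z : v z != 0 -> `|z.1| <= A /\ `|z.2| <= A by move=> /uA[].
rewrite (Rintegral_prod_yx cu uA).
rewrite -[LHS](Rintegral_prod_xy cv vA).
(* With these signs, the exchange of coordinates sends the line at [t] to the line at [- t] with the
   same parameter [r]. *)
apply: (Rintegral_nonhorizontal_lines_eq0 (c := - s) (s := - c) cv vA).
- rewrite oppr_eq0; apply: contra_eq_neq cs1 => ->.
  by rewrite c0 !expr0n addr0 eq_sym oner_eq0.
- by rewrite !sqrrN addrC.
move=> t; rewrite -[RHS](lines0 (- t)); apply: eq_Rintegral => r _.
by rewrite /v /=; congr (u (_, _)); ring.
Qed.

End two_dim.

(** * The single-angle Radon transform *)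

Section complex_valued.
Context {R : realType}.
Notation mu := (@lebesgue_measure R).
Notation Re := (@complex.Re R).
Notation Im := (@complex.Im R).
Implicit Types (phi F : R * R -> R[i]) (p : R * R).

Lemma continuous_Re (T : topologicalType) (F : T -> R[i]) :
  continuous (F : T -> R[i]^o) -> continuous (fun x => Re (F x)).
Proof.
move=> cF x; apply/cvgrPdist_lt => e e0.
have e0C : 0 < e%:C%C by rewrite ltcR.
have /cvgrPdist_lt /(_ _ e0C) := cF x.
apply: filterS => y; rewrite -ltcR; apply: le_lt_trans.
have -> : Re (F x) - Re (F y) = Re (F x - F y) by case: (F x) (F y) => ? ? [].
exact: normc_ge_Re.
Qed.

Lemma continuous_Im (T : topologicalType) (F : T -> R[i]) :
  continuous (F : T -> R[i]^o) -> continuous (fun x => Im (F x)).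
Proof.
move=> cF x; apply/cvgrPdist_lt => e e0.
have e0C : 0 < e%:C%C by rewrite ltcR.
have /cvgrPdist_lt /(_ _ e0C) := cF x.
apply: filterS => y; rewrite -ltcR; apply: le_lt_trans.
have -> : Im (F x) - Im (F y) = Im (F x - F y) by case: (F x) (F y) => ? ? [].
have -> : Im (F x - F y) = Re (- 'i%C * (F x - F y)).
  by case: (F x - F y) => ? ? /=; ring.
apply: le_trans (normc_ge_Re _) _.
by rewrite normrM normrN normc_def /= expr0n add0r expr1n sqrtr1 mul1r.
Qed.

Lemma cintegral_sum d (T : measurableType d) (m : {measure set T -> \bar R})
    (J : Type) (r : seq J) (c : J -> R[i]) (G : J -> T -> R[i]) :
  (forall j, m.-integrable setT (EFin \o (Re \o G j))) ->
  (forall j, m.-integrable setT (EFin \o (Im \o G j))) ->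
  cintegral m (fun x => \sum_(j <- r) c j * G j x) =
  \sum_(j <- r) c j * cintegral m (G j).
Proof.
move=> iRe iIm.
have iZ a (f : T -> R) : m.-integrable setT (EFin \o f) ->
    m.-integrable setT (EFin \o (fun x => a * f x)).
  by move=> /(integrableZl measurableT a).
have iReM j : m.-integrable setT (EFin \o (fun x => Re (c j * G j x))).
  have := integrableB measurableT (iZ (Re (c j)) _ (iRe j)) (iZ (Im (c j)) _ (iIm j)).
  by apply: eq_integrable => // x _ /=; rewrite ReM EFinB.
have iImM j : m.-integrable setT (EFin \o (fun x => Im (c j * G j x))).
  have := integrableD measurableT (iZ (Re (c j)) _ (iIm j)) (iZ (Im (c j)) _ (iRe j)).
  by apply: eq_integrable => // x _ /=; rewrite ImM EFinD.
have cM j : cintegral m (fun x => c j * G j x) = c j * cintegral m (G j).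
  rewrite /cintegral; apply/eqP; rewrite eq_complex ReM ImM /=; apply/andP; split.
    under eq_Rintegral do rewrite ReM.
    by rewrite RintegralB// ?RintegralZl//; do ?[exact: iRe|exact: iIm|exact: iZ (iRe _)|exact: iZ (iIm _)].
  under eq_Rintegral do rewrite ImM.
  by rewrite RintegralD// ?RintegralZl//; do ?[exact: iRe|exact: iIm|exact: iZ (iRe _)|exact: iZ (iIm _)].
have iSum (g : R[i] -> R) (gD : {morph g : x y / x + y}) (g0 : g 0 = 0) s :
    (forall j, m.-integrable setT (EFin \o (fun x => g (c j * G j x)))) ->
    m.-integrable setT (EFin \o (fun x => g (\sum_(j <- s) c j * G j x))).
  move=> ig.
  have := integrable_sum measurableT s (P := xpredT) (fun j _ => ig j).
  by apply: eq_integrable => // x _ /=; rewrite (big_morph _ gD g0) sumEFin.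
elim: r => [|j r IH].
  rewrite big_nil /cintegral; under eq_Rintegral do rewrite big_nil.
  under [X in Complex _ X]eq_Rintegral do rewrite big_nil.
  by rewrite /= !Rintegral_cst// !mul0r.
rewrite big_cons -IH -cM /cintegral; apply/eqP; rewrite eq_complex ReD ImD /=.
apply/andP; split.
  under eq_Rintegral do rewrite big_cons ReD.
  by rewrite RintegralD//; exact: (iSum _ (@ReD R)).
under eq_Rintegral do rewrite big_cons ImD.
by rewrite RintegralD//; exact: (iSum _ (@ImD R)).
Qed.

End complex_valued.

Section radon.
Context {R : realType}.
Notation mu := (@lebesgue_measure R).
Notation Re := (@complex.Re R).
Notation Im := (@complex.Im R).
Variables (phi : R * R -> R[i]) (A : nat) (p : R * R).
Hypothesis cphi : continuous (phi : R * R -> R[i]^o).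
Hypothesis phiA : forall x, phi x != 0 -> `|x.1| <= A%:R /\ `|x.2| <= A%:R.
Hypothesis p1 : p.1 ^+ 2 + p.2 ^+ 2 = 1.

Definition line (t s : R) : R * R := (t * p.1 - s * p.2, t * p.2 + s * p.1).

Let p1_le1 : `|p.1| <= 1.
Proof.
rewrite -(@expr_le1 _ 2)// -normrX ger0_norm ?sqr_ge0//.
by rewrite -p1 ?lerDl ?lerDr sqr_ge0.
Qed.

Let p2_le1 : `|p.2| <= 1.
Proof.
rewrite -(@expr_le1 _ 2)// -normrX ger0_norm ?sqr_ge0//.
by rewrite -p1 ?lerDl ?lerDr sqr_ge0.
Qed.

Lemma continuous_line t : continuous (line t).
Proof.
move=> s.
have c1 : {for s, continuous (fun s : R => t * p.1 - s * p.2)}.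
  apply: cvgB; first exact: cvg_cst.
  by apply: cvgM => //; exact: cvg_cst.
have c2 : {for s, continuous (fun s : R => t * p.2 + s * p.1)}.
  apply: cvgD; first exact: cvg_cst.
  by apply: cvgM => //; exact: cvg_cst.
exact: cvg_pair c1 c2.
Qed.

(** The map [line] is a rotation, and its inverse expresses [t] and [s] as sums of two products,
    each bounded by [A]. *)
Lemma line_support t s : phi (line t s) != 0 ->
  `|t| <= (A + A)%:R /\ `|s| <= (A + A)%:R.
Proof.
move=> /phiA [/= h1 h2]; set x1 := t * p.1 - s * p.2 in h1; set x2 := t * p.2 + s * p.1 in h2.
have prod_le (z q : R) : `|z| <= A%:R -> `|q| <= 1 -> `|z * q| <= A%:R.
  by move=> zA q1; rewrite normrM -[leRHS]mulr1 ler_pM.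
split.
  have -> : t = x1 * p.1 + x2 * p.2.
    by rewrite -[LHS]mulr1 -p1 /x1 /x2; ring.
  by rewrite (le_trans (ler_normD _ _))// natrD lerD// prod_le.
have -> : s = x2 * p.1 - x1 * p.2.
  by rewrite -[LHS]mulr1 -p1 /x1 /x2; ring.
by rewrite (le_trans (ler_normB _ _))// natrD lerD// prod_le.
Qed.

Lemma continuous_Re_line t : continuous (fun s => Re (phi (line t s))).
Proof.
move=> s; apply: (@continuous_comp _ _ _ (line t) (fun x => Re (phi x))).
  exact: continuous_line.
exact: continuous_Re.
Qed.

Lemma continuous_Im_line t : continuous (fun s => Im (phi (line t s))).
Proof.
move=> s; apply: (@continuous_comp _ _ _ (line t) (fun x => Im (phi x))).
  exact: continuous_line.
exact: continuous_Im.
Qed.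

Lemma Re_neq0 (z : R[i]) : Re z != 0 -> z != 0.
Proof. by apply: contra_neq => ->. Qed.

Lemma Im_neq0 (z : R[i]) : Im z != 0 -> z != 0.
Proof. by apply: contra_neq => ->. Qed.

Lemma integrable_Re_line t : mu.-integrable setT (EFin \o (fun s => Re (phi (line t s)))).
Proof.
apply: (@integrable_continuous_bounded_support _ _ (A + A)%:R).
  exact: continuous_Re_line.
by move=> s /Re_neq0 /line_support[].
Qed.

Lemma integrable_Im_line t : mu.-integrable setT (EFin \o (fun s => Im (phi (line t s)))).
Proof.
apply: (@integrable_continuous_bounded_support _ _ (A + A)%:R).
  exact: continuous_Im_line.
by move=> s /Im_neq0 /line_support[].
Qed.

Lemma radon_support t : radon p phi t != 0 -> `|t| <= (A + A)%:R.
Proof.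
move=> Rt; rewrite leNgt; apply/negP => tA; move/eqP: Rt; apply.
have phi0 s : phi (line t s) = 0.
  by apply/eqP/negPn/negP => /line_support[]; rewrite leNgt tA.
rewrite /radon /cintegral; apply/eqP; rewrite eq_complex /=.
under eq_Rintegral do rewrite -/(line t _) phi0.
rewrite Rintegral_cst// mul0r eqxx/=.
under eq_Rintegral do rewrite -/(line t _) phi0.
by rewrite Rintegral_cst// mul0r eqxx/=.
Qed.

(** Subtracting [k] subtracts its components along [p] and its perpendicular from [t] and [s]. The
    factor 1 matches the form of the affine change of variable. *)
Lemma line_shift (k : R * R) t s :
  line t s - k = line (t - dotp p k) (1 * s + (k.1 * p.2 - k.2 * p.1)).
Proof.
rewrite /line /dotp mul1r; congr pair => /=.
  by rewrite -[X in _ - X = _]mulr1 -p1; ring.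
by rewrite -[X in _ - X = _]mulr1 -p1; ring.
Qed.

Lemma integrable_Re_line_shift t b :
  mu.-integrable setT (EFin \o (fun s => Re (phi (line t (1 * s + b))))).
Proof.
apply: (@integrable_continuous_bounded_support _ _ ((A + A)%:R + `|b|)).
  have c1 : continuous (fun s : R => 1 * s + b).
    move=> s; apply: cvgD; last exact: cvg_cst.
    by apply: cvgM => //; exact: cvg_cst.
  move=> s; exact: (continuous_comp (c1 s) (@continuous_Re_line t _)).
move=> s /Re_neq0 /line_support[_]; rewrite mul1r => h.
by rewrite -[s](addrK b) (le_trans (ler_normB _ _))// lerD.
Qed.

Lemma integrable_Im_line_shift t b :
  mu.-integrable setT (EFin \o (fun s => Im (phi (line t (1 * s + b))))).
Proof.
apply: (@integrable_continuous_bounded_support _ _ ((A + A)%:R + `|b|)).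
  have c1 : continuous (fun s : R => 1 * s + b).
    move=> s; apply: cvgD; last exact: cvg_cst.
    by apply: cvgM => //; exact: cvg_cst.
  move=> s; exact: (continuous_comp (c1 s) (@continuous_Im_line t _)).
move=> s /Im_neq0 /line_support[_]; rewrite mul1r => h.
by rewrite -[s](addrK b) (le_trans (ler_normB _ _))// lerD.
Qed.

Lemma cintegral_shift (b t : R) :
  cintegral mu (fun s => phi (line t (1 * s + b))) = radon p phi t.
Proof.
rewrite /radon /cintegral; apply/eqP; rewrite eq_complex /=; apply/andP; split; apply/eqP.
  rewrite [RHS](@Rintegral_affine _ 1 b (fun s => Re (phi (line t s)))) ?oner_eq0//.
  - by rewrite normr1 mul1r.
  - by apply: continuous_measurable_fun; exact: continuous_Re_line.
  - exact: integrable_Re_line_shift.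
rewrite [RHS](@Rintegral_affine _ 1 b (fun s => Im (phi (line t s)))) ?oner_eq0//.
- by rewrite normr1 mul1r.
- by apply: continuous_measurable_fun; exact: continuous_Im_line.
- exact: integrable_Im_line_shift.
Qed.

(** The component of a shift along the line of integration is absorbed by translation invariance;
    only its projection on [p] remains. *)
Lemma radon_comb (J : Type) (r : seq J) (c : J -> R[i]) (k : J -> R * R) t :
  radon p (fun x => \sum_(j <- r) c j * phi (x - k j)) t =
  \sum_(j <- r) c j * radon p phi (t - dotp p (k j)).
Proof.
pose b j := (k j).1 * p.2 - (k j).2 * p.1.
transitivity (cintegral mu (fun s =>
    \sum_(j <- r) c j * phi (line (t - dotp p (k j)) (1 * s + b j)))).
  congr cintegral; apply/funext => s; apply: eq_bigr => j _.
  by rewrite -/(line t s) line_shift.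
rewrite cintegral_sum; last 2 first.
- by move=> j; exact: integrable_Re_line_shift.
- by move=> j; exact: integrable_Im_line_shift.
by apply: eq_bigr => j _; rewrite cintegral_shift.
Qed.

Lemma line_inj t s t' s' : line t s = line t' s' -> t = t' /\ s = s'.
Proof.
have tE u v : u = (line u v).1 * p.1 + (line u v).2 * p.2.
  by rewrite -[LHS]mulr1 -p1 /line /=; ring.
have sE u v : v = (line u v).2 * p.1 - (line u v).1 * p.2.
  by rewrite -[LHS]mulr1 -p1 /line /=; ring.
by move=> e; split; [rewrite (tE t s) e -tE|rewrite (sE t s) e -sE].
Qed.

Lemma lineB t s t' s' : line t s - line t' s' = line (t - t') (s - s').
Proof. by rewrite /line; congr pair => /=; ring. Qed.

Lemma continuous_comb (J : Type) (r : seq J) (c : J -> R[i]) (H : J -> R -> R[i]) :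
  (forall j, continuous (fun s => Re (H j s))) ->
  (forall j, continuous (fun s => Im (H j s))) ->
  continuous (fun s => Re (\sum_(j <- r) c j * H j s)) /\
  continuous (fun s => Im (\sum_(j <- r) c j * H j s)).
Proof.
move=> cRe cIm; elim: r => [|j r [IHRe IHIm]].
  by split=> s; under eq_fun do rewrite big_nil; exact: cvg_cst.
split=> s; under eq_fun do rewrite big_cons ?ReD ?ImD ?ReM ?ImM.
  apply: cvgD; last exact: IHRe.
  by apply: cvgB; apply: cvgM; [exact: cvg_cst|exact: cRe|exact: cvg_cst|exact: cIm].
apply: cvgD; last exact: IHIm.
by apply: cvgD; apply: cvgM; [exact: cvg_cst|exact: cIm|exact: cvg_cst|exact: cRe].
Qed.

Lemma radon_semidefinite : positive_definite phi -> semidefinite (radon p phi).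
Proof.
move=> pd T x al xinj.
(* Integrating [G] over [s] gives the quadratic form of [radon p phi]. *)
pose G s := \sum_j \sum_k al j * (al k)^*%C * phi (line (x j - x k) s).
have GE s : G s = \sum_(i <- enum {: T * T})
    (al i.1 * (al i.2)^*%C) * phi (line (x i.1 - x i.2) s).
  by rewrite /G pair_big big_enum.
have -> : \sum_j \sum_k al j * (al k)^*%C * radon p phi (x j - x k) = cintegral mu G.
  rewrite (_ : G = fun s => \sum_(i <- enum {: T * T})
    (al i.1 * (al i.2)^*%C) * phi (line (x i.1 - x i.2) s)); last exact/funext.
  rewrite cintegral_sum; last 2 first.
  - by move=> j; exact: integrable_Re_line.
  - by move=> j; exact: integrable_Im_line.
  by rewrite pair_big big_enum.
have [cRe cIm] : continuous (fun s => Re (G s)) /\ continuous (fun s => Im (G s)).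
  rewrite (funext GE : G = _).
  apply: (@continuous_comb _ (enum {: T * T}) (fun i => al i.1 * (al i.2)^*%C)
    (fun i s => phi (line (x i.1 - x i.2) s))) => j.
    exact: continuous_Re_line.
  exact: continuous_Im_line.
(* One more than the support bound, so that [G] already vanishes at distance exactly [B], as the
   Toeplitz lemma requires. *)
pose B := (A + A).+1.
have GA s : B%:R <= `|s| -> G s = 0.
  move=> sA; rewrite /G big1// => j _; rewrite big1// => k _.
  suff -> : phi (line (x j - x k) s) = 0 by rewrite mulr0.
  apply/eqP/negPn/negP => /line_support[_]; apply/negP; rewrite -ltNge.
  by apply: lt_le_trans sA; rewrite ltr_nat.
have GB s : G s != 0 -> `|s| <= B%:R.
  by apply: contra_neqT; rewrite -ltNge => /ltW; exact: GA.
have Gsum m : 0 <= \sum_(i < B * m.+1 + B * m.+1)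
    G ((i%:Z - (B * m.+1)%N%:Z)%:~R / m.+1%:R).
  apply: (@toeplitz_sum_ge0 _ (fun r : int => G (r%:~R / m.+1%:R))).
    move=> r rK; apply: GA.
    rewrite normrM normfV ler_pdivlMr ?normr_gt0 ?pnatr_eq0//.
    by rewrite normr_nat -natrM -intr_norm -abszE -pmulrn ler_nat.
  move=> n.
  (* The weights do not depend on the position along the line, so the form on the grid is a Toeplitz
     sum of samples of [G]. *)
  have := @positive_definite_finType _ phi (T * 'I_n)%type
    (fun i => line (x i.1) (i.2%:R / m.+1%:R)) (fun i => al i.1) pd.
  set S := (X in (_ -> is_true (0 <= X)) -> _).
  have -> : S = \sum_(i < n) \sum_(j < n) G ((i%:Z - j%:Z)%:~R / m.+1%:R).
    rewrite /S; under eq_bigr do under eq_bigr do rewrite lineB -mulrBl.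
    rewrite -(pair_big xpredT xpredT (fun a (i : 'I_n) => \sum_(k : T * 'I_n)
      al a * (al k.1)^*%C * phi (line (x a - x k.1) ((i%:R - k.2%:R) / m.+1%:R))))/=.
    rewrite exchange_big/=; apply: eq_bigr => i _.
    under eq_bigr => a _.
      rewrite -(pair_big xpredT xpredT (fun b (j : 'I_n) =>
        al a * (al b)^*%C * phi (line (x a - x b) ((i%:R - j%:R) / m.+1%:R))))/=.
      rewrite exchange_big/=; over.
    rewrite exchange_big/=; apply: eq_bigr => j _.
    by rewrite /G rmorphB/=.
  apply=> -[a i] [b j] /= /line_inj[/xinj -> ij]; congr pair.
  apply/val_inj/eqP; rewrite /= -(eqr_nat R); apply/eqP.
  by apply: (mulIf _ ij); rewrite invr_eq0 pnatr_eq0.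
rewrite lecE /cintegral /=; apply/andP; split.
  (* The Riemann sums of [Im G] vanish, so the Riemann criterion applies both to [Im G] and to its
     opposite. *)
  rewrite eq_le; apply/andP; split.
    rewrite -oppr_ge0 -mulN1r -RintegralZl//; last first.
      by apply: (@integrable_continuous_bounded_support _ _ B%:R) => // s /Im_neq0 /GB.
    apply: (@Rintegral_ge0_riemann _ _ B).
    - by move=> s; apply: cvgM; [exact: cvg_cst|exact: cIm].
    - by move=> s; rewrite mulN1r oppr_eq0 => /Im_neq0 /GB.
    - move=> m; have := Gsum m; rewrite lecE Im_sum => /andP[/eqP/= im0 _].
      by rewrite -mulr_sumr im0 mulr0.
  apply: (@Rintegral_ge0_riemann _ _ B) => //.
  - by move=> s /Im_neq0 /GB.
  - by move=> m; have := Gsum m; rewrite lecE Im_sum => /andP[/eqP/= -> _].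
apply: (@Rintegral_ge0_riemann _ _ B) => //.
- by move=> s /Re_neq0 /GB.
- by move=> m; have := Gsum m; rewrite lecE Re_sum => /andP[_].
Qed.

Lemma radon_neq0 : fourier phi 0 != 0 -> exists t, radon p phi t != 0.
Proof.
move=> f0; apply: contrapT => /forallNP r0; move/negP: f0; apply.
have rad0 t : radon p phi t = 0 by apply/eqP/negPn/negP; exact: r0.
have -> : fourier phi 0 = cintegral leb2 phi.
  congr cintegral; apply/funext => x.
  rewrite /dotp /= !mulr0 addr0 /expNi cos0 sin0.
  by case: (phi x) => u v; apply/eqP; rewrite eq_complex/=; apply/andP; split; apply/eqP; ring.
rewrite /cintegral eq_complex /=; apply/andP; split; apply/eqP.
  apply: (@Rintegral_lines_eq0 _ (fun x => Re (phi x)) A%:R p.1 p.2) => //.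
  - exact: continuous_Re.
  - by move=> x /Re_neq0 /phiA.
  - by move=> t; have := rad0 t => /(congr1 Re).
apply: (@Rintegral_lines_eq0 _ (fun x => Im (phi x)) A%:R p.1 p.2) => //.
- exact: continuous_Im.
- by move=> x /Im_neq0 /phiA.
- by move=> t; have := rad0 t => /(congr1 Im).
Qed.

End radon.

(** * Finiteness of the index set and admissible directions *)

Lemma finite_int_itv (a b : int) : finite_set [set k : int | a <= k <= b].
Proof.
apply: (@sub_finite_set _ _ ((fun i : nat => a + i%:Z) @` `I_(absz (b - a)).+1)).
  move=> k /= /andP[ak kb]; exists (absz (k - a)) => /=; lia.
exact/finite_image/finite_II.
Qed.

Lemma finite_index_set (R : realType) (N M a b : R * R) :
  finite_set (index_set N M a b).
Proof.
apply: (@sub_finite_set _ _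
  ([set k : int | Num.ceil (a.1 - M.1) <= k <= Num.floor (b.1 - N.1)] `*`
   [set k : int | Num.ceil (a.2 - M.2) <= k <= Num.floor (b.2 - N.2)])).
  by move=> k /andP[].
by apply: finite_setX; exact: finite_int_itv.
Qed.

Lemma directionsP (R : realType) (p : R * R) :
  directions p -> p.1 ^+ 2 + p.2 ^+ 2 = 1.
Proof. by move=> [th _ <-]; exact: cos2Dsin2. Qed.

(** If two indices had the same projection, [p] would be orthogonal to their nonzero difference.
    Being a unit vector, [p] would then be the direction of a null vector, namely itself. *)
Lemma dotp_intpt_inj (R : realType) (E : set (int * int)) (p : R * R) :
  (directions `\` dv (null_vectors (differences E))) p ->
  {in E &, injective (fun k => dotp p (intpt k))}.
Proof.
move=> [pdir pnull] k l /set_mem Ek /set_mem El kl.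
apply/eqP/negPn/negP => klN; apply: pnull.
have p1 := directionsP pdir; case: pdir => th _ pE.
exists p, th; split => //; last first.
  by rewrite /norm2 p1 sqrtr1 pE scale1r.
  apply: contra_eq_neq p1 => ->; by rewrite /= expr0n addr0 eq_sym oner_neq0.
split.
  apply: contra_eq_neq p1 => ->; by rewrite /= expr0n addr0 eq_sym oner_neq0.
exists (intpt k - intpt l); split; first by exists k, l.
- apply: contra_neq klN => /eqP; rewrite subr_eq0 /intpt => /eqP[/intr_inj k1 /intr_inj k2].
  by case: (k) (l) k1 k2 => ? ? [? ?] /= -> ->.
- move: kl; rewrite /dotp /= => kl; apply/eqP; rewrite -subr_eq0 in kl *.
  by apply/eqP; move: kl; lra.
Qed.
Unset Implicit Arguments.

Theorem theorem5p4 (R : realType) (phi : R * R -> R[i]) (N M a b : R * R)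
    (phi_cont : continuous (phi : R * R -> R[i]^o))
    (phi_compact : compact (supp phi))
    (phi_indep : shifts_independent phi)
    (phi_pd : positive_definite phi)
    (phi_smooth : ((1 / 2)%:E < nu2 phi)%E)
    (phi_hat0 : 0 < fourier phi 0)
    (phi_supp : supp phi `<=` rectangle N M)
    (f : R * R -> R[i])
    (f_V : in_V phi f)
    (f_supp : supp f `<=` rectangle a b)
    (f_span : in_span phi (index_set N M a b) f)
    (p : R * R)
    (p_dir : (directions `\` dv (null_vectors (differences (index_set N M a b)))) p) :
  determined_by_radon_samples phi (index_set N M a b) p
    [set dotp p (intpt k) | k in index_set N M a b] f.
Proof.
have finE := @finite_index_set R N M a b.
set E := index_set N M a b in finE p_dir f_span *.
have [A phiA] : exists A : nat, forall x, phi x != 0 ->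
    `|x.1| <= A%:R /\ `|x.2| <= A%:R.
  (* A crude common bound for all four sides of the rectangle. *)
  pose K := `|N.1| + `|N.2| + (`|M.1| + `|M.2|).
  exists (Num.bound K) => x phix.
  have KA := ltW (archi_boundP (_ : 0 <= K)).
  have /andP[/andP[? ?] /andP[? ?]] : rectangle N M x.
    by apply: phi_supp; exact: subset_closure.
  have := ler_norm N.1; have := ler_norm (- N.1); have := ler_norm N.2; have := ler_norm (- N.2).
  have := ler_norm M.1; have := ler_norm (- M.1); have := ler_norm M.2; have := ler_norm (- M.2).
  rewrite !normrN => *.
  have : K <= (Num.bound K)%:R by apply: KA; rewrite /K; lra.
  by rewrite /K => *; rewrite !ler_norml; split; apply/andP; split; lra.
have p1 := directionsP p_dir.1.
case: f_span => c fE h [d hE] samples.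
have lincombE (q : int * int -> R[i]) :
    lincomb phi E q = fun x => \sum_(k <- fset_set E) q k * phi (x - intpt k).
  by apply/funext => x; rewrite /lincomb fsbig_finite.
(* Uniqueness is proved at the level of coefficients; their values outside [E] do not enter the
   sums. *)
suff dc k : E k -> d k = c k.
  rewrite hE fE; apply/funext => x; apply: eq_fsbigr => k /set_mem Ek.
  by rewrite dc.
move=> Ek.
pose t (j : fset_set E) : R := dotp p (intpt (val j)).
have inE_val (j : fset_set E) : val j \in E.
  by rewrite -(in_fset_set finE); exact: valP.
have tinj : injective t.
  by move=> i j /(dotp_intpt_inj p_dir (inE_val i) (inE_val j))/val_inj.
pose e (j : fset_set E) := d (val j) - c (val j).
suff e0 : forall j, e j = 0.
  have kE : (k \in fset_set E)%fset by rewrite in_fset_set//; apply/mem_set.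
  by have /eqP := e0 [` kE]%fset; rewrite subr_eq0 => /eqP.
have psi0 := radon_neq0 phi_cont phiA p1 (lt0r_neq0 phi_hat0).
apply: (translates_independent (radon_support phiA p1) psi0 tinj).
(* It remains to treat the sample points [t j], where the vanishing of the combination is the
   equality of the two samples. *)
apply: (semidefinite_kernel (radon_semidefinite phi_cont phiA p1 phi_pd) tinj) => j.
have Ej : E (val j) by apply/set_mem.
have := samples (t j); rewrite hE fE !lincombE !(radon_comb phi_cont phiA p1).
rewrite !(big_seq_fsetE _ (fset_set E) xpredT)/=.
move=> /(_ (ex_intro2 _ _ _ Ej erefl)) /eqP; rewrite -subr_eq0 -sumrB => /eqP sum0.
by rewrite -[RHS]sum0; apply: eq_bigr => k' _; rewrite mulrBl.
Qed.
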